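(* Let $P$ be a connected (naturally labeled) poset on $n$ elements. Then $\mathrm{DC}(P) = \mathfrak{S}_n$ if and only if $P$ is a rooted tree.
   Context: All posets are finite. A poset is connected if its Hasse diagram is connected; it is a rooted tree if it has a unique minimal element and its Hasse diagram is a tree. For a poset $(P,\preceq)$, $a \lessdot b$ denotes a cover relation, and $\check{P} = P \cup \{\hat 0\}$ is $P$ with a new minimum $\hat 0$ adjoined (even if $P$ already has a minimum). $P$ is naturally labeled if its ground set is $\{1,\dots,n\}$, $n = |P|$, and $a \prec b$ implies $a < b$ as integers; one sets $\hat 0 := 0$. For $\tau \in \mathfrak{S}_n$ set $\tau(0) := 0$. For a saturated chain $C = \{\hat 0 = c_1 \lessdot \cdots \lessdot c_k = a\}$ in $\check{P}$ let $\mathrm{des}(\tau|_C)$ be the number of $1 \le j < k$ with $\tau(c_j) > \tau(c_{j+1})$. The permutation $\tau$ is descent-compatible with $P$ if for every $a \in P$ the number $\mathrm{des}(\tau|_C)$ is the same for all saturated chains $C$ in $\check{P}$ from $\hat 0$ to $a$. $\mathrm{DC}(P) \subseteq \mathfrak{S}_n$ is the set of descent-compatible permutations. *)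

(* Defs.v *)
From mathcomp Require Import all_boot all_fingroup.
From mathcomp Require Import classical_sets.

Set Implicit Arguments.
Unset Strict Implicit.
Unset Printing Implicit Defensive.

Section FinitePoset.
Variables (T : finType) (le : rel T).

Definition partial_order : Prop :=
  [/\ reflexive le, antisymmetric le & transitive le].

Definition strict : rel T := fun a b => (a != b) && le a b.

Definition covers : rel T :=
  fun a b => strict a b && ~~ [exists c, strict a c && strict c b].

Definition minimal (a : T) : bool := ~~ [exists b, strict b a].

(* Adjacency in the Hasse diagram, as an undirected simple graph. *)
Definition hasse : rel T := fun a b => covers a b || covers b a.

Definition saturated_chain (a b : T) (C : seq T) : bool :=
  [&& ohead C == Some a, last a C == b & sorted covers C].

End FinitePoset.

(* The empty graph does not count as connected. *)
Definition connected_graph (T : finType) (e : rel T) : Prop :=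
  (0 < #|T|)%N /\ forall x y : T, connect e x y.

(* A cycle of size 2 only traverses a single edge back and forth. *)
Definition acyclic_graph (T : finType) (e : rel T) : Prop :=
  forall c : seq T, ucycle e c -> (size c <= 2)%N.

Definition tree_graph (T : finType) (e : rel T) : Prop :=
  connected_graph e /\ acyclic_graph e.

Definition connected_poset (T : finType) (le : rel T) : Prop :=
  connected_graph (hasse le).

Definition rooted_tree (T : finType) (le : rel T) : Prop :=
  (exists! r : T, minimal le r) /\ tree_graph (hasse le).

(* The ground set {1, ..., n} is represented by 'I_n, the ordinal i standing   *)
(* for the label i + 1.                                                        *)
Definition naturally_labeled n (le : rel 'I_n) : Prop :=
  forall a b : 'I_n, strict le a b -> (a < b)%N.

(* The order on P with a new minimum adjoined, that minimum being None. *)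
Definition le_hat (T : finType) (le : rel T) : rel (option T) :=
  fun x y => match x, y with
             | None, _ => true
             | Some _, None => false
             | Some a, Some b => le a b
             end.

(* tau in one-based values, extended by tau(0) = 0. *)
Definition perm_hat n (tau : 'S_n) (x : option 'I_n) : nat :=
  if x is Some a then (tau a).+1 else 0%N.

Definition des n (tau : 'S_n) (C : seq (option 'I_n)) : nat :=
  #|[pred j : 'I_(size C).-1
      | (perm_hat tau (nth None C j) > perm_hat tau (nth None C j.+1))%N]|.

Definition descent_compatible n (le : rel 'I_n) (tau : 'S_n) : Prop :=
  forall (a : 'I_n) (C D : seq (option 'I_n)),
    saturated_chain (le_hat le) None (Some a) C ->
    saturated_chain (le_hat le) None (Some a) D ->
    des tau C = des tau D.

Definition DC n (le : rel 'I_n) : set 'S_n :=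
  [set tau | descent_compatible le tau]%classic.

(* Main.v *)
Require Import Defs.
From mathcomp Require Import all_boot all_fingroup.
From mathcomp Require Import classical_sets.

Set Implicit Arguments.
Unset Strict Implicit.
Unset Printing Implicit Defensive.

(** Both conditions say that no element of the connected poset P covers two
    elements. If every element covers at most one, saturated chains from the
    adjoined minimum are unique, a minimal element lies below its whole
    connected component, and the largest label on a cycle of length at least 3
    would cover both of its neighbours. If a covers b and c with labels b < c,
    the transposition (c a) has no descent along a saturated chain to a through
    b, but a descent at c, a on a chain through c; and if moreover P has a unique
    minimal element, descending from b and from c to it closes a cycle
    through a. *)

(** Compare the paths from their common end backwards: [e_uniq] forces each preceding vertex, and
    since no edge enters [x0], neither path can continue once the other has reached its start. *)
Lemma path_to_unique (T : Type) (e : rel T) (x0 : T) (s t : seq T) :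
  (forall x, ~~ e x x0) -> (forall x y z, e y x -> e z x -> y = z) ->
  path e x0 s -> path e x0 t -> last x0 s = last x0 t -> s = t.
Proof.
move=> e0 e_uniq; elim/last_ind: s t => [|s x IHs] t.
  case/lastP: t => // t x _; rewrite rcons_path last_rcons => /andP[_ etx] /= x0E.
  by move: etx; rewrite -x0E (negPf (e0 _)).
rewrite rcons_path last_rcons => /andP[ps esx].
case/lastP: t => [_ /= xE|t y]; first by move: esx; rewrite xE (negPf (e0 _)).
rewrite rcons_path last_rcons => /andP[pt ety] xy.
by subst y; rewrite (IHs t ps pt) //; apply: e_uniq esx ety.
Qed.

Lemma des_eq0 n (tau : 'S_n) (C : seq (option 'I_n)) :
  (des tau C == 0) = sorted (fun x y => perm_hat tau x <= perm_hat tau y) C.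
Proof.
apply/eqP/(sortedP None) => [/card0_eq C0 i iC|C_le].
  have iC1 : i < (size C).-1 by case: (size C) iC.
  by have /negbT := C0 (Ordinal iC1); rewrite inE /= -leqNgt.
apply: eq_card0 => i; rewrite inE; apply/negbTE; rewrite -leqNgt.
by apply: C_le; case: i => i /=; case: (size C).
Qed.

Definition unique_lower_cover (T : finType) (le : rel T) : Prop :=
  forall x y z : T, covers le y x -> covers le z x -> y = z.

Section HatCovers.
Variables (T : finType) (le : rel T).

Lemma strict_hat (a b : T) :
  strict (le_hat le) (Some a) (Some b) = strict le a b.
Proof. by []. Qed.

Lemma covers_hat (a b : T) :
  covers (le_hat le) (Some a) (Some b) = covers le a b.
Proof.
rewrite /covers strict_hat; congr (_ && ~~ _); apply/existsP/existsP.
  by case=> -[c|] // abc; exists c.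
by case=> c abc; exists (Some c).
Qed.

Lemma covers_hat_None (x : option T) : ~~ covers (le_hat le) x None.
Proof. by case: x. Qed.

Lemma covers_None_hat (a : T) :
  covers (le_hat le) None (Some a) = minimal le a.
Proof.
rewrite /covers /minimal /=; congr (~~ _); apply/existsP/existsP.
  by case=> -[c|] // /andP[_ ca]; exists c.
by case=> c ca; exists (Some c).
Qed.

(** The only new covers put [None] below minimal elements, and these have no lower cover in the
    original order. *)
Lemma unique_lower_cover_hat :
  unique_lower_cover le -> unique_lower_cover (le_hat le).
Proof.
have minN a b : minimal le a -> covers le b a -> False.
  by move=> /existsPn/(_ b)/negP ba /andP[/ba].
move=> le_uniq [x|] [y|] [z|] //; rewrite ?covers_hat ?covers_None_hat.
- by move=> yx zx; rewrite (le_uniq _ _ _ yx zx).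
- by move=> yx /minN/(_ yx).
- by move=> /minN xmin /xmin.
Qed.

End HatCovers.

Lemma unique_lower_cover_DC n (le : rel 'I_n) :
  unique_lower_cover le -> DC le = [set: 'S_n]%classic.
Proof.
move=> /unique_lower_cover_hat le_uniq; apply/seteqP; split=> // tau _.
move=> a [|x C] [|y D]; rewrite /saturated_chain //=.
move=> /and3P[/eqP[->] /eqP lC pC] /and3P[/eqP[->] /eqP lD pD].
have lCD : last None C = last None D by rewrite lC lD.
by rewrite (path_to_unique (covers_hat_None le) le_uniq pC pD lCD).
Qed.

Section NaturallyLabeled.
Variables (n : nat) (le : rel 'I_n).
Hypotheses (le_po : partial_order le) (le_nat : naturally_labeled le).

Lemma covers_ltn a b : covers le a b -> a < b.
Proof. by case/andP=> /le_nat. Qed.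

Lemma le_leq a b : le a b -> a <= b.
Proof.
by have [-> //|ab le_ab] := eqVneq a b; rewrite ltnW// le_nat// /strict ab.
Qed.

Lemma lower_cover_above (m y : 'I_n) :
  strict le m y -> exists2 z, covers le z y & le m z.
Proof.
case: le_po => le_refl le_anti le_trans my.
have Pm : le m m && strict le m y by rewrite le_refl.
(* Take [z] with the largest label: by natural labeling, anything strictly between [z] and [y] would
   be a candidate with a larger label. *)
case: (@arg_maxnP _ m (fun z => le m z && strict le z y) val Pm).
move=> z /andP[mz zy] z_max; exists z => //; rewrite /covers zy /=.
apply/existsPn => c; apply/negP => /andP[zc cy].
have mc : le m c by case/andP: zc => _; apply: le_trans.
have := z_max c; rewrite mc cy => /(_ isT); rewrite /= leqNgt => /negP; apply.
exact: le_nat.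
Qed.

Lemma not_minimal_covers (x : 'I_n) :
  ~~ minimal le x -> exists z, covers le z x.
Proof.
by move=> /negPn/existsP[m /lower_cover_above[z zx _]]; exists z.
Qed.

Lemma saturated_chain_to (b : 'I_n) :
  exists2 s, path (covers (le_hat le)) None s & last None s = Some b.
Proof.
have [k] := ubnP (val b); elim: k b => // k IHk b bk.
have [bmin|/not_minimal_covers[z zb]] := boolP (minimal le b).
  by exists [:: Some b]; rewrite //= covers_None_hat bmin.
have [|s ps ls] := IHk z; first exact: leq_trans (covers_ltn zb) bk.
exists (rcons s (Some b)); rewrite ?last_rcons//.
by rewrite rcons_path ps ls covers_hat.
Qed.

Lemma saturated_chain_rcons (a b : 'I_n) (s : seq (option 'I_n)) :
  path (covers (le_hat le)) None s -> last None s = Some b -> covers le b a ->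
  saturated_chain (le_hat le) None (Some a) (None :: rcons s (Some a)).
Proof.
move=> ps ls ba.
by rewrite /saturated_chain /= last_rcons !eqxx rcons_path ps ls covers_hat.
Qed.

(** Labels increase along the chain, so if the last one is below [c], all are, and the transposition
    moves none of them. The condition on the last entry is vacuous for the chain that stays at
    [None]. *)
Lemma path_tperm_leq (a c : 'I_n) (s : seq (option 'I_n)) :
  c < a -> path (covers (le_hat le)) None s ->
  (forall b, last None s = Some b -> b < c) ->
  path (fun x y => perm_hat (tperm c a) x <= perm_hat (tperm c a) y) None s.
Proof.
move=> ca; elim/last_ind: s => // s [x|]; last first.
  by rewrite !rcons_path (negPf (covers_hat_None _ _)) andbF.
rewrite !rcons_path last_rcons => IHs /andP[ps sx] /(_ x erefl) xc.
case E: (last None s) sx => [y|] sx; last by rewrite IHs // E.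
move: sx; rewrite covers_hat => /covers_ltn yx.
have fixed (z : 'I_n) : z < c -> tperm c a z = z.
  move=> zc; rewrite tpermD // -val_eqE /= gtn_eqF //.
  exact: ltn_trans zc ca.
have yc := ltn_trans yx xc.
rewrite IHs // => [|z]; last by rewrite E => -[<-].
by rewrite /= !fixed // ltnS ltnW.
Qed.

Lemma DC_unique_lower_cover :
  DC le = [set: 'S_n]%classic -> unique_lower_cover le.
Proof.
move=> DCT.
suff noDC a b c : covers le b a -> covers le c a -> b < c -> False.
  move=> a b c ba ca; apply/val_inj/eqP.
  by case: ltngtP => // [/(noDC a b c ba ca)|/(noDC a c b ca ba)].
move=> ba ca bc; have lt_ca := covers_ltn ca.
have [s ps ls] := saturated_chain_to b.
have [t pt lt] := saturated_chain_to c.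
have tauDC : descent_compatible le (tperm c a).
  by have : DC le (tperm c a) by rewrite DCT.
have desE := tauDC a _ _ (saturated_chain_rcons ps ls ba)
                         (saturated_chain_rcons pt lt ca).
(* Descent-compatibility replaces this chain by the one through [b]; there the values increase up to
   [b], which is fixed, and the final step goes from [b] to the image [c] of [a]. *)
have : des (tperm c a) (None :: rcons t (Some a)) == 0.
  rewrite -desE des_eq0 /= rcons_path path_tperm_leq //=; last first.
    by move=> x; rewrite ls => -[<-].
  rewrite ls /= tpermR tpermD ?ltnS; first exact: ltnW.
    by rewrite -val_eqE /= gtn_eqF.
  by rewrite -val_eqE /= gtn_eqF // (ltn_trans bc).
(* The final step from [c] to [a] takes the value [a] down to [c]. *)
by rewrite des_eq0 /= rcons_path lt /= tpermL tpermR ltnS leqNgt lt_ca andbF.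
Qed.

Lemma exists_minimal : 0 < n -> exists r, minimal le r.
Proof.
move=> n_gt0; exists (Ordinal n_gt0); apply/existsPn => b.
by apply/negP => /le_nat.
Qed.

(** The set of elements above [m] is closed under Hasse adjacency, hence everything by
    connectedness. Going down from [z] stays in it: [z] differs from [m] by minimality, so some
    lower cover of [z] lies above [m], and [z] has only one. *)
Lemma minimal_le_all (m : 'I_n) :
  unique_lower_cover le -> connected_poset le -> minimal le m ->
  forall x, le m x.
Proof.
case: le_po => le_refl le_anti le_trans le_uniq [_ le_conn] m_min x.
have up y z : covers le y z -> le m y -> le m z.
  by case/andP=> /andP[_ yz] _ my; apply: le_trans yz.
have down y z : covers le y z -> le m z -> le m y.
  move=> yz mz; have [mE|m_neq] := eqVneq m z.
    by case/existsPn/(_ y)/negP: m_min; rewrite mE; case/andP: yz.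
  have [|w wz mw] := @lower_cover_above m z; first by rewrite /strict m_neq.
  by rewrite (le_uniq _ _ _ yz wz).
have walk p y : le m y -> path (hasse le) y p -> le m (last y p).
  elim: p y => //= z p IHp y my /andP[yz]; apply: IHp.
  by case/orP: yz => [/up|/down]; apply.
by have /connectP[p pp ->] := le_conn m x; apply: walk.
Qed.

Lemma unique_lower_cover_acyclic :
  unique_lower_cover le -> acyclic_graph (hasse le).
Proof.
move=> le_uniq c /andP[c_cycle c_uniq]; rewrite leqNgt; apply/negP => c_size.
have [x0 x0c] : exists x, x \in c.
  by case: c c_size {c_cycle c_uniq} => // x c _; exists x; rewrite mem_head.
case: (@arg_maxnP _ x0 (mem c) val x0c) => x xc x_max.
have lower y : y \in c -> hasse le x y || hasse le y x -> covers le y x.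
  move=> yc; have: ~~ covers le x y.
    by apply/negP => /covers_ltn; rewrite ltnNge; apply/negP/negPn/x_max.
  by rewrite /hasse => /negPf->; rewrite /= orbF orbb.
(* Rotate the cycle to start at its maximum [x]: the neighbours of [x] are then the second and the
   last entry, distinct because the cycle has at least three entries. *)
have [i s sE] := rot_to xc.
have s_mem : c =i x :: s by move=> y; rewrite -sE mem_rot.
have s_cycle : path.cycle (hasse le) (x :: s) by rewrite -sE rot_cycle.
have s_uniq : uniq (x :: s) by rewrite -sE rot_uniq.
have s_size : 2 < size (x :: s) by rewrite -sE size_rot.
case: s {sE} s_mem s_cycle s_uniq s_size => [|y s]//.
case/lastP: s => [|s z]// s_mem.
rewrite [path.cycle _ _]/= rcons_path last_rcons => /and3P[xy _ zx] s_uniq _.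
have yx : covers le y x by apply: lower; rewrite ?xy// s_mem !inE eqxx orbT.
have zx' : covers le z x.
  by apply: lower; rewrite ?zx ?orbT// s_mem !inE mem_rcons mem_head !orbT.
move: s_uniq; rewrite (le_uniq _ _ _ yx zx') /= mem_rcons mem_head.
by rewrite andbF.
Qed.

Lemma unique_lower_cover_rooted_tree :
  connected_poset le -> unique_lower_cover le -> rooted_tree le.
Proof.
move=> le_conn le_uniq; have [n_gt0 _] := le_conn; rewrite card_ord in n_gt0.
split; last by split=> //; apply: unique_lower_cover_acyclic.
have [r r_min] := exists_minimal n_gt0; exists r; split=> // m m_min.
apply/eqP; apply: contraLR m_min => rm; apply/negPn/existsP; exists r.
by rewrite /strict rm; apply: minimal_le_all.
Qed.

(** Keep passing to a lower cover; labels decrease, so the walk stops only at [r]. The bound by [a]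
    guarantees that the walk avoids [a], which will close the cycle. *)
Lemma connect_below_minimal (a r x : 'I_n) :
  (forall m, minimal le m -> r = m) -> x < a ->
  connect [rel y z | [&& hasse le y z, y < a & z < a]] x r.
Proof.
move=> r_uniq; have [k] := ubnP (val x); elim: k x => // k IHk x xk xa.
have [/r_uniq->//|/not_minimal_covers[z zx]] := boolP (minimal le x).
have za := ltn_trans (covers_ltn zx) xa.
apply: connect_trans (IHk z (leq_trans (covers_ltn zx) xk) za).
by apply: connect1; rewrite /= /hasse zx orbT xa za.
Qed.

Lemma rooted_tree_unique_lower_cover :
  rooted_tree le -> unique_lower_cover le.
Proof.
case=> -[r [_ r_uniq]] [_ le_acyc] a b c ba ca; apply/eqP.
apply: contraT => b_neq_c.
pose e := [rel y z | [&& hasse le y z, y < a & z < a]].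
have e_sym : connect_sym e.
  apply: sym_connect_sym => y z; rewrite /= /hasse orbC.
  by congr (_ && _); rewrite andbC.
have : connect e b c.
  apply: connect_trans (connect_below_minimal r_uniq (covers_ltn ba)) _.
  by rewrite e_sym; apply: connect_below_minimal (covers_ltn ca).
case/connectP=> p0 ep0 cE; subst c; move: ca b_neq_c.
(* Two descents to [r] may share vertices; shortening yields the repetition-free path that [ucycle]
   requires. *)
case/shortenP: ep0 => p ep p_uniq _ ca b_neq_c.
have a_notin : a \notin b :: p.
  apply/negP; rewrite inE => /orP[/eqP aE|ap].
    by have := covers_ltn ba; rewrite aE ltnn.
  have /allP/(_ a ap) : all (fun y : 'I_n => y < a) p.
    elim: p b ep {ba ca b_neq_c p_uniq ap} => //= y p IHp b.
    by case/andP=> /and3P[_ _ ->] /IHp.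
  by rewrite ltnn.
have hp : path (hasse le) b p by apply: sub_path ep => y z /andP[].
have : ucycle (hasse le) (a :: b :: p).
  rewrite /ucycle cons_uniq a_notin p_uniq /= rcons_path hp andbT.
  by rewrite /hasse ba ca orbT.
(* A cycle of size at most 2 leaves [p] empty, so its endpoint would be [b] itself. *)
by move/le_acyc; case: p b_neq_c {ep p_uniq a_notin hp ca} => //=; rewrite eqxx.
Qed.

End NaturallyLabeled.

Theorem proposition3p2 (n : nat) (le : rel 'I_n)
  (le_po : partial_order le)
  (le_nat : naturally_labeled le)
  (le_conn : connected_poset le) :
  DC le = [set: 'S_n]%classic <-> rooted_tree le.
Proof.
split=> [/(DC_unique_lower_cover le_po le_nat)|].
  exact: unique_lower_cover_rooted_tree.
by move/(rooted_tree_unique_lower_cover le_po le_nat)/unique_lower_cover_DC.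
Qed.
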